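(* Let $\mathscr{P}_A(X)$ be a weak* compact collection of probability measures on $(X,\mathcal{B}_X)$ and let the channel be described by $W_{Q_v}(\cdot|x)$. If the mutual information $P\mapsto I(P,W_{Q_v}|R)$ is (weak* ) continuous over $\mathscr{P}_A(X)$, then it is bounded and achieves its maximum on $\mathscr{P}_A(X)$.
   Context: Setting. $X,Y,S,V$ (input, output, state and side-information alphabets) are separable locally compact Hausdorff spaces (e.g. $\mathbb{R}^n$ or $\mathbb{C}^n$) with Borel $\sigma$-algebras $\mathcal{B}_X,\mathcal{B}_Y,\mathcal{B}_S,\mathcal{B}_V$. $\mathscr{P}(X)$ denotes the set of Radon probability measures on $(X,\mathcal{B}_X)$, and similarly for the other spaces. For each $x\in X$, $s\in S$, $W(\cdot|x,s)\in\mathscr{P}(Y)$; for each $v\in V$, $Q_v$ is a (conditional) probability measure on $(S,\mathcal{B}_S)$; $R$ is a probability measure on $(V,\mathcal{B}_V)$. All of these depend measurably on their parameters. The channel with side information is $W_{Q_v}(E|x)=\int W(E|x,s)\,dQ_v(s)$, $E\in\mathcal{B}_Y$. For $P\in\mathscr{P}(X)$, $PW_{Q_v}$ is the output measure $PW_{Q_v}(B)=\int W_{Q_v}(B|x)\,dP(x)$, $B\in\mathcal{B}_Y$. Relative entropy: $D(P\|Q)=\int\log_2\frac{dP}{dQ}\,dP$ if $P\ll Q$, and $+\infty$ otherwise. Mutual information: $I(P,W_{Q_v}|R)=\iint D(W_{Q_v}(\cdot|x)\|PW_{Q_v})\,dP(x)\,dR(v)$, regarded as a real-valued function on $\mathscr{P}_A(X)$.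 Weak* convergence: $P_n\xrightarrow{w^*}P$ iff $\int f\,dP_n\to\int f\,dP$ for every bounded continuous $f:X\to\mathbb{R}$. A collection of probability measures is weak* compact if every sequence in it has a subsequence converging weakly* to a member of the collection. Continuity of a functional means that $P_n\xrightarrow{w^*}P$ implies convergence of its values. *)

(* Defs.v *)
From HB Require Import structures.
From mathcomp Require Import all_boot all_order all_algebra.
From mathcomp Require Import all_classical all_reals all_analysis.
From mathcomp Require Import measurable_realfun.

Set Implicit Arguments.
Unset Strict Implicit.
Unset Printing Implicit Defensive.

Import Order.TTheory GRing.Theory Num.Theory.
Import numFieldNormedType.Exports.

Local Open Scope classical_set_scope.
Local Open Scope ring_scope.
Local Open Scope ereal_scope.

(* [borelType T] has the same carrier as [T], so that subsets and functions may
   be regarded as topological or as measurable objects. *)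
Notation borelType T := (g_sigma_algebraType (@open T)).

Definition separable (T : topologicalType) : Prop :=
  exists2 D : set T, countable D & dense D.

(* Compact sets are Borel as soon as [T] is Hausdorff, which is always assumed
   when this predicate is used. *)
Definition radon (R : realType) (T : ptopologicalType)
    (mu : {measure set (borelType T) -> \bar R}) : Prop :=
  [/\ forall K : set T, compact K -> mu K < +oo,
      forall B : set (borelType T), measurable B ->
        mu B = ereal_inf [set mu U | U in [set U : set T | open U /\ B `<=` U]]
    & forall U : set T, open U ->
        mu U = ereal_sup
                 [set mu K | K in [set K : set T | compact K /\ K `<=` U]]].

Section kernel_prob.
Context d d' (X : measurableType d) (Y : measurableType d') (R : realType).
Variables (k : R.-pker X ~> Y) (x : X).

Definition kernel_prob : set Y -> \bar R := k x.

HB.instance Definition _ := Measure.on kernel_prob.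

Let kernel_prob_setT : kernel_prob setT = 1.
Proof. exact: prob_kernel. Qed.

HB.instance Definition _ :=
  Measure_isProbability.Build _ _ _ kernel_prob kernel_prob_setT.

End kernel_prob.

Section side_channel.
Context d d' d'' (X : measurableType d) (S : measurableType d')
  (Y : measurableType d'') (R : realType).
Variables (W : R.-pker (X * S) ~> Y) (q : probability S R).

Definition side_channel (x : X) (E : set Y) : \bar R := \int[q]_s W (x, s) E.

Let cstq : R.-pker X ~> S :=
  kprobability (@measurable_cst _ _ X (pprobability S R) setT q).

Let side_channelE x E : side_channel x E = (cstq \; W) x E.
Proof. by []. Qed.

Let side_channel0 x : side_channel x set0 = 0.
Proof. by rewrite side_channelE measure0. Qed.

Let side_channel_ge0 x E : 0 <= side_channel x E.
Proof. by rewrite side_channelE. Qed.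

Let side_channel_sigma_additive x : semi_sigma_additive (side_channel x).
Proof. exact: (@measure_semi_sigma_additive _ _ _ ((cstq \; W) x)). Qed.

HB.instance Definition _ x := isMeasure.Build _ Y R (side_channel x)
  (side_channel0 x) (side_channel_ge0 x) (@side_channel_sigma_additive x).

Definition mside_channel : X -> {measure set Y -> \bar R} := side_channel.

Let measurable_side_channel E :
  measurable E -> measurable_fun [set: X] (mside_channel ^~ E).
Proof.
exact: (@KCOMP_FINITE_KERNEL.measurable_fun_kcomp_finite
          _ _ _ _ _ _ _ cstq W).
Qed.

HB.instance Definition _ :=
  isKernel.Build _ _ X Y R mside_channel measurable_side_channel.

Let side_channel_setT x : mside_channel x setT = 1.
Proof.
rewrite /mside_channel/= /side_channel.
under eq_integral do rewrite prob_kernel.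
rewrite integral_cst// mul1e; exact: probability_setT.
Qed.

HB.instance Definition _ :=
  Kernel_isProbability.Build _ _ X Y R mside_channel side_channel_setT.

End side_channel.

Section output.
Context d d' (X : measurableType d) (Y : measurableType d') (R : realType).
Variables (P : probability X R) (k : R.-pker X ~> Y).

Definition output (B : set Y) : \bar R := \int[P]_x k x B.

Let output0 : output set0 = 0.
Proof. by apply: integral0_eq => x _; rewrite measure0. Qed.

Let output_ge0 B : 0 <= output B.
Proof. by apply: integral_ge0 => x _; exact: measure_ge0. Qed.

Let output_sigma_additive : semi_sigma_additive output.
Proof.
move=> F mF tF mUF.
rewrite [X in _ --> X](_ : _ = \int[P]_x (\sum_(n <oo) k x (F n))); last first.
  by apply: eq_integral => x _; apply/esym/cvg_lim => //;
     exact/measure_semi_sigma_additive.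
apply/cvg_closeP; split.
  by apply: is_cvg_nneseries => n _ _; exact: integral_ge0.
rewrite closeE// integral_nneseries// => n.
exact: measurable_kernel.
Qed.

HB.instance Definition _ := isMeasure.Build _ Y R output
  output0 output_ge0 output_sigma_additive.

Let output_setT : output setT = 1.
Proof.
rewrite /output; under eq_integral do rewrite prob_kernel.
rewrite integral_cst// mul1e; exact: probability_setT.
Qed.

HB.instance Definition _ :=
  Measure_isProbability.Build _ _ _ output output_setT.

End output.

Local Open Scope charge_scope.

Definition relative_entropy d (T : measurableType d) (R : realType)
    (P Q : probability T R) : \bar R :=
  if `[< P `<< Q >] then
    \int[P]_x (lne (('d (charge_of_finite_measure P) '/d Q) x)
               * ((ln 2)^-1)%:E)
  else +oo.

Definition mutual_information d d' d1 d2 (X : measurableType d)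
    (Y : measurableType d') (S : measurableType d1) (V : measurableType d2)
    (R : realType) (W : R.-pker (X * S) ~> Y) (Q : R.-pker V ~> S)
    (RV : probability V R) (P : probability X R) : \bar R :=
  \int[RV]_v \int[P]_x
    relative_entropy (kernel_prob (mside_channel W (kernel_prob Q v)) x)
                     (output P (mside_channel W (kernel_prob Q v))).

Definition weak_cvg (R : realType) (X : ptopologicalType)
    (u : nat -> probability (borelType X) R)
    (P : probability (borelType X) R) : Prop :=
  forall f : X -> R, continuous f -> bounded_fun f ->
    (\int[u n]_x f x)%R @[n --> \oo] --> (\int[P]_x f x)%R.

Definition weak_compact (R : realType) (X : ptopologicalType)
    (A : set (probability (borelType X) R)) : Prop :=
  forall u : nat -> probability (borelType X) R, (forall n, A (u n)) ->
  exists (phi : nat -> nat) (P : probability (borelType X) R),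
    [/\ {homo phi : m n / (m < n)%N}, A P & weak_cvg (u \o phi) P].

Definition weak_continuous_on (R : realType) (X : ptopologicalType)
    (A : set (probability (borelType X) R))
    (F : probability (borelType X) R -> \bar R) : Prop :=
  forall (u : nat -> probability (borelType X) R)
         (P : probability (borelType X) R),
    (forall n, A (u n)) -> A P -> weak_cvg u P -> F (u n) @[n --> \oo] --> F P.

(* Main.v *)
Require Import Defs.
From mathcomp Require Import all_boot all_order all_algebra.
From mathcomp Require Import all_classical all_reals all_analysis.
From mathcomp Require Import measurable_realfun.

Import Order.TTheory GRing.Theory Num.Theory.
Import numFieldNormedType.Exports.

Local Open Scope classical_set_scope.
Local Open Scope ring_scope.
Local Open Scope ereal_scope.

(** This is the extreme value theorem for a weakly continuous functional on a sequentially compact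
    set of measures. A maximizing sequence has a subsequence converging weakly inside the set, and
    continuity identifies its limiting value with the supremum ([weak_compact_max]). The same
    argument for [\- F] yields a minimum, and two finite extremal values bound the functional
    ([weak_compact_bounded]). *)

(** Strict monotonicity forces [n <= phi n]. This is what lets a limit pass to a subsequence. *)
Lemma ltn_homo_cvg_infty (phi : nat -> nat) :
  {homo phi : m n / (m < n)%N} -> phi @ \oo --> \oo.
Proof.
move=> phi_homo; have leq_phi n : (n <= phi n)%N.
  by elim: n => // n IHn; exact: leq_ltn_trans IHn (phi_homo _ _ (ltnSn n)).
by move=> B [N _ NB]; exists N => // n /= Nn; apply: NB => /=; exact: leq_trans Nn _.
Qed.

Section weak_extreme_value.
Context {R : realType} {X : ptopologicalType}.
Implicit Types (A : set (probability (borelType X) R))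
  (F : probability (borelType X) R -> \bar R).

Lemma weak_continuous_onN A F :
  weak_continuous_on A F -> weak_continuous_on A (\- F).
Proof. by move=> F_cont u P Au AP uP; apply: cvgeN; exact: F_cont. Qed.

(* The limit of [F] along a convergent subsequence of a maximizing sequence is
   both [F P0] and the supremum, taken in the extended reals. *)
Lemma weak_compact_max A F : A !=set0 -> weak_compact A ->
  weak_continuous_on A F -> exists2 P0, A P0 & forall P, A P -> F P <= F P0.
Proof.
move=> [P1 AP1] A_compact F_cont.
have FA_neq0 : F @` A != set0 by apply/set0P; exists (F P1), P1.
(* The supremum may be [+oo] at this stage; a sequence of values tending to it exists all the same,
   and [choice] lifts these values to measures in [A]. *)
have [y FAy y_sup] := ereal_sup_seq FA_neq0.
have /choice[u Fu] n : exists P, A P /\ F P = y n.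
  by have [P AP FP] := FAy n; exists P.
have Au n : A (u n) by have [] := Fu n.
have [phi [P0 [phi_homo AP0 uP0]]] := A_compact u Au.
have FuP0 : F ((u \o phi) n) @[n --> \oo] --> F P0.
  by apply: F_cont => // n; exact: Au.
have Fu_sup : F ((u \o phi) n) @[n --> \oo] --> ereal_sup (F @` A).
  rewrite [X in X @ _](_ : _ = y \o phi); last first.
    by apply/funext => n /=; have [] := Fu (phi n).
  exact: (cvg_comp _ _ (ltn_homo_cvg_infty _ phi_homo) y_sup).
exists P0 => // P AP; rewrite (cvg_unique (@ereal_hausdorff R) FuP0 Fu_sup).
by apply: ereal_sup_ubound; exists P.
Qed.

Lemma weak_compact_min A F : A !=set0 -> weak_compact A ->
  weak_continuous_on A F -> exists2 P0, A P0 & forall P, A P -> F P0 <= F P.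
Proof.
move=> A_neq0 A_compact /weak_continuous_onN.
move=> /(weak_compact_max _ _ A_neq0 A_compact)[P0 AP0 maxP0].
by exists P0 => // P /maxP0; rewrite leeN2.
Qed.

(** Extremal values are attained in [\bar R] and could be infinite; finiteness of [F] on [A] is what
    turns them into a real bound. *)
Lemma weak_compact_bounded A F : A !=set0 -> weak_compact A ->
  (forall P, A P -> F P \is a fin_num) -> weak_continuous_on A F ->
  exists M : R, forall P, A P -> `|F P| <= M%:E.
Proof.
move=> A_neq0 A_compact F_fin F_cont.
have [P0 AP0 maxP0] := weak_compact_max _ _ A_neq0 A_compact F_cont.
have [P1 AP1 minP1] := weak_compact_min _ _ A_neq0 A_compact F_cont.
(* From [F P1 <= F P <= F P0], [F P] is at most the first entry of the maximum and [- F P] at most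
   the second. *)
exists (Num.max (fine (F P0)) (- fine (F P1)))%R => P AP.
have := minP1 _ AP; have := maxP0 _ AP.
rewrite -(fineK (F_fin _ AP)) -(fineK (F_fin _ AP0)) -(fineK (F_fin _ AP1)).
rewrite abse_EFin !lee_fin ler_norml lerNl !le_max lerN2 => -> ->.
by rewrite orbT.
Qed.

End weak_extreme_value.

Theorem proposition4p1 (R : realType) (X Y S V : ptopologicalType)
  (sepX : separable X) (lcX : locally_compact [set: X]) (hX : hausdorff_space X)
  (sepY : separable Y) (lcY : locally_compact [set: Y]) (hY : hausdorff_space Y)
  (sepS : separable S) (lcS : locally_compact [set: S]) (hS : hausdorff_space S)
  (sepV : separable V) (lcV : locally_compact [set: V]) (hV : hausdorff_space V)
  (W : R.-pker (borelType X * borelType S) ~> borelType Y)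
  (W_radon : forall (x : X) (s : S), radon (W (x, s)))
  (Q : R.-pker (borelType V) ~> (borelType S))
  (RV : probability (borelType V) R)
  (PA : set (probability (borelType X) R))
  (PA_neq0 : PA !=set0)
  (PA_radon : forall P, PA P -> radon P)
  (PA_compact : weak_compact PA)
  (I_real : forall P, PA P -> mutual_information W Q RV P \is a fin_num)
  (I_continuous : weak_continuous_on PA (mutual_information W Q RV)) :
  (exists M : R, forall P, PA P -> `|mutual_information W Q RV P| <= M%:E) /\
  (exists2 P0, PA P0 &
     forall P, PA P -> mutual_information W Q RV P <= mutual_information W Q RV P0).
Proof.
split; first exact: weak_compact_bounded.
exact: weak_compact_max.
Qed.
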